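(* The following assertions hold. (1) $\mathcal{C}(\Delta_X)=1_{PX}$, for every set $X$. (2) For all sets $X,Y,Z$ and all monotone relations $r$ from $PX$ to $Y$ and $s$ from $PY$ to $Z$, $\mathcal{C}(s\circ r)=\mathcal{C}(s)\cdot\mathcal{C}(r)$. (3) For all sets $X,Y$ and all monotone relations $r,r'$ from $PX$ to $Y$, $r\subseteq r'$ if and only if $\mathcal{C}(r)\le\mathcal{C}(r')$. (4) For every map $f:X\to Y$, $\mathcal{C}(f_\#)=Pf$ and $\mathcal{C}(f^\#)=Qf$.
   Context: $PX$ denotes the powerset of $X$. For a map $f:X\to Y$, $Pf:PX\to PY$ is the direct image function $A\mapsto f(A)$ and $Qf:PY\to PX$ is the inverse image function $B\mapsto f^{-1}(B)$, which is right adjoint to $Pf$. For relations $r$ from $X$ to $Y$ and $s$ from $Y$ to $Z$, $s\cdot r$ is the usual relational composite: $x\,(s\cdot r)\,z$ iff there is $y\in Y$ with $x\,r\,y$ and $y\,s\,z$. For a function $f:X\to Y$, $f^\circ$ is the relation from $Y$ to $X$ with $y\,f^\circ\,x$ iff $f(x)=y$. For a relation $r$ from $X$ to $Y$, $\hat{P}r$ is the relation from $PX$ to $PY$ with $A\,(\hat{P}r)\,B$ iff for all $y\in B$ there is $x\in A$ with $x\,r\,y$. Let $e_X:X\to PX$, $x\mapsto\{x\}$, and $m_X:PPX\to PX$, $\mathcal{A}\mapsto\bigcup\mathcal{A}$. A relation $r$ from $PX$ to $Y$ is monotone if $A\,r\,y$ and $A\subseteq B$ imply $B\,r\,y$. For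 relations $r$ from $PX$ to $Y$ and $s$ from $PY$ to $Z$, $s\circ r:=s\cdot(\hat{P}r)\cdot m_X^\circ$, a relation from $PX$ to $Z$. $\Delta_X$ is the relation from $PX$ to $X$ with $A\,\Delta_X\,x$ iff $x\in A$. For a function $f:X\to Y$ define the monotone relations $f_\#:=e_Y^\circ\cdot\hat{P}f$ from $PX$ to $Y$ and $f^\#:=e_X^\circ\cdot\hat{P}(f^\circ)$ from $PY$ to $X$; explicitly, $A\,f_\#\,y$ iff $y\in f(A)$, and $B\,f^\#\,x$ iff $x\in f^{-1}(B)$. For a relation $r$ from $PX$ to $Y$, $\mathcal{C}(r):PX\to PY$ is the map $A\mapsto\{y\in Y\mid A\,r\,y\}$. Maps $PX\to PY$ are ordered pointwise by inclusion: $c\le d$ iff $c(A)\subseteq d(A)$ for all $A\subseteq X$. *)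

(* Defs.v *)
From mathcomp Require Import all_boot.
From mathcomp Require Export boolp classical_sets.

Set Implicit Arguments.
Unset Strict Implicit.
Unset Printing Implicit Defensive.

Local Open Scope classical_set_scope.

(* The powerset PX is [set X], and a relation from X to Y is a subset of X * Y,
   so that [`<=`] is inclusion of relations.  The usual relational composite
   [s . r] is the library's [(s \; r)%relation], which also applies the right
   operand first. *)
Definition hrel (X Y : Type) := set (X * Y).

Definition graph (X Y : Type) (f : X -> Y) : hrel X Y :=
  [set xy | f xy.1 = xy.2].

Definition conv_graph (X Y : Type) (f : X -> Y) : hrel Y X :=
  ((graph f)^-1)%relation.

Definition Phat (X Y : Type) (r : hrel X Y) : hrel (set X) (set Y) :=
  [set AB | forall y, AB.2 y -> exists2 x, AB.1 x & r (x, y)].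

Definition Pmap (X Y : Type) (f : X -> Y) : set X -> set Y := fun A => f @` A.

Definition Qmap (X Y : Type) (f : X -> Y) : set Y -> set X := fun B => f @^-1` B.

Definition eP (X : Type) : X -> set X := fun x => [set x].

Definition mP (X : Type) : set (set X) -> set X :=
  fun AA => \bigcup_(A in AA) A.

Definition monotone_rel (X Y : Type) (r : hrel (set X) Y) : Prop :=
  forall (A B : set X) (y : Y), r (A, y) -> A `<=` B -> r (B, y).

Definition kcomp (X Y Z : Type) (s : hrel (set Y) Z) (r : hrel (set X) Y) :
    hrel (set X) Z :=
  (s \; (Phat r \; conv_graph (@mP X)))%relation.

Definition Delta (X : Type) : hrel (set X) X := [set Ax | Ax.1 Ax.2].

(* f_# : A is related to y iff y is in f(A). *)
Definition lower_sharp (X Y : Type) (f : X -> Y) : hrel (set X) Y :=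
  (conv_graph (@eP Y) \; Phat (graph f))%relation.

(* f^# : B is related to x iff x is in the preimage of B. *)
Definition upper_sharp (X Y : Type) (f : X -> Y) : hrel (set Y) X :=
  (conv_graph (@eP X) \; Phat (conv_graph f))%relation.

Definition Cmap (X Y : Type) (r : hrel (set X) Y) : set X -> set Y :=
  fun A => [set y | r (A, y)].

Definition le_map (X Y : Type) (c d : set X -> set Y) : Prop :=
  forall A : set X, c A `<=` d A.

(* Main.v *)
Require Import Defs.
From mathcomp Require Import all_boot.
From mathcomp Require Import boolp classical_sets.

(** The map [Cmap] only curries a relation, so identity and order are preserved
    for free; the content lies in unfolding the Kleisli composite.  A set [A]
    is related to [z] by [kcomp s r] when some family [AA] of subsets with
    union [A] and some [B] satisfy [s (B, z)], every point of [B] being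
    [r]-related to some member of [AA].  Since [r] is monotone, such a point is
    already [r]-related to [A], whence [B `<=` Cmap r A], and monotonicity of
    [s] gives [s (Cmap r A, z)] ([Phat_bigcup_sub],
    [Cmap_kcomp]).
    Conversely the one-member family [[set A]] and [B := Cmap r A] witness the
    composite.

    For the two liftings of a function, composing [Phat r] with the converse
    of the unit only tests singletons, and [Phat r] relates [A] to [[set y]]
    exactly when [y] is in the relational image of [A]
    ([Cmap_unit_Phat]).  For the graph of [f] this image is the direct image,
    for its converse the preimage. *)

Local Open Scope classical_set_scope.

(** Monotonicity absorbs the choice of a member of the family: whatever is
    related to one member is related to the union. *)
Lemma Phat_bigcup_sub (X Y : Type) (r : hrel (set X) Y)
    (AA : set (set X)) (B : set Y) :
  monotone_rel r -> Phat r (AA, B) -> B `<=` Cmap r (mP AA).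
Proof.
move=> mr rAB y By; have [A AAA rAy] := rAB y By.
by apply: mr rAy _ => x Ax; exists A.
Qed.

Lemma Cmap_kcomp (X Y Z : Type) (r : hrel (set X) Y) (s : hrel (set Y) Z) :
  monotone_rel r -> monotone_rel s ->
  Cmap (kcomp s r) = Cmap s \o Cmap r.
Proof.
move=> mr ms; apply/funext => A; apply/seteqP; split=> z /=.
  move=> [B /= [AA AAA rAB] sBz].
  have <- : mP AA = A := AAA.
  by apply: (ms B) sBz _; exact: Phat_bigcup_sub mr rAB.
move=> sz; exists (Cmap r A) => //=; exists [set A] => /=.
  exact: bigcup_set1.
by move=> y rAy; exists A.
Qed.

(** Singletons turn [Phat r] back into the relational image under [r]; this
    treats [lower_sharp] and [upper_sharp] uniformly. *)
Lemma Cmap_unit_Phat (X Y : Type) (r : hrel X Y) (A : set X) :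
  Cmap (conv_graph (@eP Y) \; Phat r)%relation A =
  [set y | exists2 x, A x & r (x, y)].
Proof.
apply/seteqP; split=> y /=.
  move=> [B /= rAB eB]; apply: rAB => /=.
  by have <- : [set y] = B := eB.
by move=> rAy; exists [set y] => //= y' /= ->.
Qed.

Theorem proposition7 :
  (forall X : Type, Cmap (@Delta X) = (fun A : set X => A)) /\
  (forall (X Y Z : Type) (r : hrel (set X) Y) (s : hrel (set Y) Z),
     monotone_rel r -> monotone_rel s ->
     Cmap (kcomp s r) = Cmap s \o Cmap r) /\
  (forall (X Y : Type) (r r' : hrel (set X) Y),
     monotone_rel r -> monotone_rel r' ->
     (r `<=` r' <-> le_map (Cmap r) (Cmap r'))) /\
  (forall (X Y : Type) (f : X -> Y),
     Cmap (lower_sharp f) = Pmap f /\ Cmap (upper_sharp f) = Qmap f).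
Proof.
split; first by [].
split; first by move=> X Y Z r s; exact: Cmap_kcomp.
split=> [X Y r r' _ _|X Y f].
  by split=> [rr' A y|rr' [A y]]; [exact: rr' | exact: rr'].
split; apply/funext => A; rewrite Cmap_unit_Phat //.
rewrite /Qmap; apply/seteqP; split=> x /=.
  by move=> [y Ay fxy]; have -> : f x = y := fxy.
by move=> Afx; exists (f x).
Qed.
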